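(* Let $\Gamma$ be the sub-algebra of $M_3(\mathbb{C})[x]$ consisting of the polynomials of the form $$\begin{pmatrix} r_0^{11}&r_0^{12}&r_0^{13}\\ 0&r_0^{22}&r_0^{23}\\ 0&0&r_0^{11}\end{pmatrix}+\begin{pmatrix} r_1^{11}&r_1^{12}&r_1^{13}\\ r_0^{22}-r_0^{11}&r_1^{22}&r_1^{23}\\ 0&r_0^{22}-r_0^{11}&r_1^{11}+r_0^{23}-r_0^{12}\end{pmatrix}x$$ $$+\begin{pmatrix} r_2^{11}&r_2^{12}&r_2^{13}\\ r_1^{22}-r_1^{11}-r_0^{23}+r_0^{12}&r_2^{22}&r_2^{23}\\ r_0^{22}-r_0^{11}&r_1^{22}-r_1^{11}&r_2^{11}+r_1^{23}-r_1^{12}\end{pmatrix}x^2+\begin{pmatrix} r_3^{11}&r_3^{12}&r_3^{13}\\ r_3^{21}&r_3^{22}&r_3^{23}\\ r_1^{22}-2r_1^{11}-r_0^{23}+r_0^{12}&r_3^{32}&r_3^{33}\end{pmatrix}x^3$$ $$+\begin{pmatrix} r_4^{11}&r_4^{12}&r_4^{13}\\ r_4^{21}&r_4^{22}&r_4^{23}\\ r_3^{32}+r_3^{21}-r_2^{22}-r_2^{11}+r_1^{12}&r_4^{32}&r_4^{33}\end{pmatrix}x^4$$ $$+\begin{pmatrix} r_5^{11}&r_5^{12}&r_5^{13}\\ r_5^{21}&r_5^{22}&r_5^{23}\\ r_4^{32}+r_4^{21}-r_3^{33}-r_3^{22}-r_3^{11}+r_2^{23}+r_2^{12}-r_1^{13}&r_5^{32}&r_5^{33}\end{pmatrix}x^5+x^6p(x),$$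 where $p\in M_3(\mathbb{C})[x]$ and all the variables $r_0^{11},r_0^{12},\dots,r_5^{33}\in\mathbb{C}$ are arbitrary. Then $\Gamma=\mathbb{A}$. Moreover, for each $\theta\in\Gamma$ there is an explicit expression for the operator $\mathcal{B}$: if $\theta(x)=\sum_{j=0}^{M}a_jx^j\in\Gamma$, then $$\mathcal{B}=\sum_{j=0}^{M}\partial_z^j\cdot\Big(a_j+\sum_{l=1}^{M-j}\frac{(-1)^l}{z^l}\sum_{r=j+l-1}^{M}(\mu^{l-1})_{jr}\,S^{r-j-l+1}P_r(\theta)\Big)$$ satisfies $(\psi\mathcal{B})(x,z)=\theta(x)\psi(x,z)$, where $\mu$ is the $(M+1)\times(M+1)$ matrix with entries indexed by $0\le r,j\le M$ given by $\mu_{rj}=(-1)^{r-j}$ if $r+2\le j\le\min\{r+3,M\}$, $\mu_{rj}=r$ if $j=r+1$, and $\mu_{rj}=0$ otherwise.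
   Context: $S=\begin{pmatrix}0&1&0\\ 0&0&1\\ 0&0&0\end{pmatrix}$, $S^0=I$, $[X,Y]=XY-YX$. For $k\in\mathbb{N}=\{0,1,2,\dots\}$ and $\theta\in M_3(\mathbb{C}[x])$, $P_k(\theta)=\frac{\theta^{(k+1)}(0)}{k!}-\sum_{j=k+2}^{k+3}(-1)^{k-j}\big[\frac{\theta^{(j)}(0)}{j!},S^{j-k-1}\big]$. Let $\psi(x,z)=e^{xz}\big(Iz-Ix^{-1}+Sx^{-2}-S^2x^{-3}\big)$, for $x\in\mathbb{C}\setminus\{0\}$, $z\in\mathbb{C}$. A differential operator $\mathcal{B}=\mathcal{B}(z,\partial_z)=\sum_{j=0}^{m}\partial_z^j\cdot b_j(z)$ (with $b_j$ $3\times3$ matrix valued meromorphic functions on a suitable nonempty connected open subset of $\mathbb{C}$) acts on $\psi$ from the right by $\psi\mathcal{B}=\sum_{j=0}^{m}(\partial_z^j\psi)\,b_j(z)$, and $$\mathbb{A}=\{\theta\in M_3(\mathbb{C}[x])\mid \exists\,\mathcal{B}=\mathcal{B}(z,\partial_z):\ (\psi\mathcal{B})(x,z)=\theta(x)\psi(x,z)\}.$$ *)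

(* Defs.v *)
(* MathComp-Analysis; the complex numbers are R[i] for an arbitrary R : realType. *)
From HB Require Import structures.
From mathcomp Require Import all_boot all_order all_algebra.
From mathcomp Require Import complex.
From mathcomp Require Import all_classical all_reals all_analysis.

Set Implicit Arguments.
Unset Strict Implicit.
Unset Printing Implicit Defensive.

Import Order.TTheory GRing.Theory Num.Theory.
Import numFieldNormedType.Exports.

Local Open Scope classical_set_scope.
Local Open Scope ring_scope.

(* R[i] packed as a numClosedFieldType, so that it gets the topology and the
   normed-module structure over itself attached to every numFieldType (a bare
   R[i] only carries its R-module structure).  Derivatives of functions
   CC R -> CC R are therefore complex derivatives. *)
Definition CC (R : realType) : numClosedFieldType := R[i]%C.

Section Defs.
Variable R : realType.
Local Notation C := (CC R).
Local Notation M3 := 'M[C]_3.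

Definition cexp (z : C) : C :=
  (expR (complex.Re z) * cos (complex.Im z) +i*
   (expR (complex.Re z) * sin (complex.Im z)))%C.

Definition holomorphic_at (f : C -> C) (z : C) : Prop :=
  \forall w \near z, derivable f w 1.

(* z^' is the filter of punctured neighbourhoods: a meromorphic function is a
   total function whose values at its poles are irrelevant. *)
Definition meromorphic_at (f : C -> C) (z : C) : Prop :=
  exists (n : nat) (g : C -> C), holomorphic_at g z /\
    \forall w \near z^', f w = g w / (w - z) ^+ n.

Definition mx_holomorphic_at (F : C -> M3) (z : C) : Prop :=
  forall i j, holomorphic_at (fun w => F w i j) z.

Definition mx_meromorphic_on (U : set C) (F : C -> M3) : Prop :=
  forall z, U z -> forall i j, meromorphic_at (fun w => F w i j) z.

Definition mx_deriven (n : nat) (F : C -> M3) (z : C) : M3 :=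
  \matrix_(i, j) derive1n n (fun w => F w i j) z.

Definition mx3 (rows : seq (seq C)) : M3 := \matrix_(i, j) (nth [::] rows i)`_j.

Definition Smx : M3 := mx3 [:: [:: 0; 1; 0];
                               [:: 0; 0; 1];
                               [:: 0; 0; 0]].

Definition bracket (X Y : M3) : M3 := X * Y - Y * X.

(* M_3(C[x]) is identified with {poly 'M[C]_3}; theta^`(n).[0] is the value at
   0 of the n-th derivative.  As j > k, (-1) ^+ (j - k) is (-1)^(k-j). *)
Definition Pmap (k : nat) (theta : {poly M3}) : M3 :=
  (k`!%:R : C)^-1 *: (theta^`(k.+1)).[0]
  - \sum_(k.+2 <= j < k.+4)
      (-1 : C) ^+ (j - k) *:
        bracket ((j`!%:R : C)^-1 *: (theta^`(j)).[0]) (Smx ^+ (j - k - 1)).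

Definition psi (x z : C) : M3 :=
  cexp (x * z) *: (z%:M - (x^-1)%:M + x ^- 2 *: Smx - x ^- 3 *: Smx ^+ 2).

(* The operator \sum_(j <= m) d_z^j . b_j acting from the right. *)
Definition right_act (m : nat) (b : nat -> C -> M3) (F : C -> M3) (z : C) : M3 :=
  \sum_(j < m.+1) mx_deriven j F z * b j z.

Definition is_diffop (U : set C) (m : nat) (b : nat -> C -> M3) : Prop :=
  [/\ open U, connected U, U !=set0 &
      forall j, (j <= m)%N -> mx_meromorphic_on U (b j)].

Definition bispectral_at (m : nat) (b : nat -> C -> M3) (theta : {poly M3})
    (x z : C) : Prop :=
  right_act m b (psi x) z = theta.[x%:M] * psi x z.

(* The algebra \mathbb{A}: psi B = theta psi is required at every x <> 0 and
   every z in the domain which is a pole of no coefficient of B. *)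
Definition bisp_alg : set {poly M3} :=
  [set theta | exists (U : set C) (m : nat) (b : nat -> C -> M3),
     is_diffop U m b /\
     forall x z : C, x != 0 -> U z ->
       (forall j, (j <= m)%N -> mx_holomorphic_at (b j) z) ->
       bispectral_at m b theta x z].

Section GammaPoly.
(* r k i j is r_k^{ij}, with 1-based i and j as in the formulas. *)
Variables (r : nat -> nat -> nat -> C) (p : {poly M3}).

Definition Gamma_poly : {poly M3} :=
  (mx3 [:: [:: r 0 1 1; r 0 1 2; r 0 1 3];
           [:: 0;       r 0 2 2; r 0 2 3];
           [:: 0;       0;       r 0 1 1]])%:P
  + (mx3 [:: [:: r 1 1 1; r 1 1 2; r 1 1 3];
             [:: r 0 2 2 - r 0 1 1; r 1 2 2; r 1 2 3];
             [:: 0; r 0 2 2 - r 0 1 1; r 1 1 1 + r 0 2 3 - r 0 1 2]])%:P * 'X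
  + (mx3 [:: [:: r 2 1 1; r 2 1 2; r 2 1 3];
             [:: r 1 2 2 - r 1 1 1 - r 0 2 3 + r 0 1 2; r 2 2 2; r 2 2 3];
             [:: r 0 2 2 - r 0 1 1; r 1 2 2 - r 1 1 1;
                 r 2 1 1 + r 1 2 3 - r 1 1 2]])%:P * 'X^2
  + (mx3 [:: [:: r 3 1 1; r 3 1 2; r 3 1 3];
             [:: r 3 2 1; r 3 2 2; r 3 2 3];
             [:: r 1 2 2 - 2 * r 1 1 1 - r 0 2 3 + r 0 1 2;
                 r 3 3 2; r 3 3 3]])%:P * 'X^3
  + (mx3 [:: [:: r 4 1 1; r 4 1 2; r 4 1 3];
             [:: r 4 2 1; r 4 2 2; r 4 2 3];
             [:: r 3 3 2 + r 3 2 1 - r 2 2 2 - r 2 1 1 + r 1 1 2;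
                 r 4 3 2; r 4 3 3]])%:P * 'X^4
  + (mx3 [:: [:: r 5 1 1; r 5 1 2; r 5 1 3];
             [:: r 5 2 1; r 5 2 2; r 5 2 3];
             [:: r 4 3 2 + r 4 2 1 - r 3 3 3 - r 3 2 2 - r 3 1 1
                 + r 2 2 3 + r 2 1 2 - r 1 1 3;
                 r 5 3 2; r 5 3 3]])%:P * 'X^5
  + 'X^6 * p.

End GammaPoly.

Definition Gamma : set {poly M3} :=
  [set theta | exists r p, theta = Gamma_poly r p].

(* c%:M *: theta is the multiplication of theta by the scalar c : C. *)
Definition is_subalgebra (A : set {poly M3}) : Prop :=
  [/\ A 1,
      forall (c : C) theta eta, A theta -> A eta -> A (c%:M *: theta + eta) &
      forall theta eta, A theta -> A eta -> A (theta * eta)].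

Definition mu_mx (M : nat) : 'M[C]_(M.+1) :=
  \matrix_(r < M.+1, j < M.+1)
    if (r.+2 <= j <= minn r.+3 M)%N then (-1) ^+ (j - r)
    else if (j == r.+1 :> nat) then r%:R
    else 0.

(* The coefficient b_j for theta = \sum_(j <= M) a_j x^j.  The exponent
   r-j-l+1 is written r.+1 - j - l, and the lower bound j+l-1 is (j + l).-1:
   l >= 1 and r >= j+l-1, so nothing is truncated.  Only z <> 0 matters. *)
Definition Bcoef (M : nat) (a : nat -> M3) (theta : {poly M3})
    (j : nat) (z : C) : M3 :=
  a j + \sum_(1 <= l < (M - j).+1)
    ((-1) ^+ l / z ^+ l) *:
      \sum_((j + l).-1 <= r < M.+1)
        (mu_mx M ^+ l.-1) (inord j) (inord r) *: (Smx ^+ (r.+1 - j - l) * Pmap r theta).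

End Defs.

(* Main.v *)
Require Import Defs.
From HB Require Import structures.
From mathcomp Require Import all_boot all_order all_algebra.
From mathcomp Require Import complex.
From mathcomp Require Import all_classical all_reals all_analysis.
From mathcomp Require Import ssrAC ring lra zify.

Import Order.TTheory GRing.Theory Num.Theory.
Import numFieldNormedType.Exports.

Local Open Scope classical_set_scope.
Local Open Scope ring_scope.

Set Implicit Arguments.
Unset Strict Implicit.
Unset Printing Implicit Defensive.

(** Put T = x + S. Since S ^ 3 = 0, the inverse of T is
    x^-1 - S x^-2 + S^2 x^-3, hence psi = e^(xz) (z - T^-1). For an operator
    with coefficients b_j put beta(x) = \sum_j b_j x^j. The product rule gives
    e^(-xz) (psi B) = beta' + (z - T^-1) beta, so for a fixed z the equation
    psi B = theta psi is an identity between Laurent polynomials in x: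
      beta' + (z - T^-1) beta = theta (z - T^-1)      [bispectral_atE].

    Conjugation by T removes T^-1 from the left-hand side. With
    phi = T^-1 theta T and beta = theta + T delta the identity becomes
      delta' + z delta = g,   where g = - phi' T^-1 does not depend on z.

    If such a delta exists, then e^(xz) g is the derivative of e^(xz) delta
    and has no residue at x = 0. As beta is a polynomial, delta has a pole of
    order at most 3 and g one of order at most 4, so this residue is a
    polynomial of degree at most 3 in z whose coefficients are, up to
    factorials, the polar coefficients of g. It vanishes at four different
    values of z, so g is a polynomial; then phi' = - g T is a polynomial, and
    so is phi [intertwining_tame].

    Conversely, let phi and q = phi' T^-1 be polynomials. For z <> 0 the finite
    sum delta = \sum_(l >= 1) (-1)^l z^-l q^(l-1) solves delta' + z delta = - q
    [neumann_resolvent]. Its coefficients are those of the explicit operator: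
    P_k(theta) is the coefficient of x^k in T q [coef_Tlin_Pmap], and the
    matrix mu, weighted by powers of S, is the matrix of T u |-> T u' on
    coefficients [Tlin_deriv_recurrence, mu_powers].

    The algebra of bispectral polynomials is therefore the set of tame theta,
    those with theta T = T phi and phi' = q T for polynomials phi and q. It is
    stable under products by the Leibniz rule,
      (phi1 phi2)' = (q1 theta2 + phi1 q2) T          [tameM],
    and it is cut out by linear equations on the first six coefficients of
    theta [tameP]. Solved entry by entry, these equations are the
    parametrization of Gamma [Gamma_tame]. *)

(** * Conjugation by a linear polynomial *)

Section Algebra.
Variables (F : numFieldType) (A : unitAlgType F).

(** Differences of distinct scalars are units of A, so the bound on the number
    of roots holds although A is not commutative. *)
Lemma poly_scalar_roots_eq0 (p : {poly A}) (rs : seq F) :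
  uniq rs -> (size p <= size rs)%N ->
  (forall c, c \in rs -> p.[c%:A] = 0) -> p = 0.
Proof.
move=> urs szp p0; apply: contraTeq szp => pn0; rewrite -ltnNge.
rewrite -(size_map (in_alg A)); apply: max_ring_poly_roots => //.
  by apply/allP => _ /mapP[c crs ->]; apply/rootP/p0.
by rewrite map_uniq_roots.
Qed.

Lemma horner_scalarM (p q : {poly A}) (c : F) :
  (p * q).[c%:A] = p.[c%:A] * q.[c%:A].
Proof.
by apply: hornerM_comm; rewrite /comm_poly -scalerAl mul1r -scalerAr mulr1.
Qed.

Lemma take_poly_eq0P (n : nat) (p : {poly A}) :
  reflect (exists q, p = 'X^n * q) (take_poly n p == 0).
Proof.
apply: (iffP eqP) => [p0|[q ->]].
  exists (drop_poly n p).
  by rewrite -{1}(poly_take_drop n p) p0 add0r commr_polyXn.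
by apply/polyP => i; rewrite coef_take_poly coefXnM coef0; case: ltnP.
Qed.

Lemma mulXn_inj (n : nat) : injective (fun p : {poly A} => 'X^n * p).
Proof. by move=> p q /= pq; apply: (monic_lreg (monicXn _ n)). Qed.

Lemma commXn n (p : {poly A}) : p * 'X^n = 'X^n * p.
Proof. exact: commr_polyXn. Qed.

Lemma comm_scalar (c : F) (p : {poly A}) : p * (c%:A)%:P = (c%:A)%:P * p.
Proof.
by apply/polyP => i; rewrite coefCM coefMC -scalerAl mul1r -scalerAr mulr1.
Qed.

Lemma mulXnCA n (p q : {poly A}) : p * ('X^n * q) = 'X^n * (p * q).
Proof. by rewrite mulrA commXn mulrA. Qed.

Lemma mul_scalarCA (c : F) (p q : {poly A}) :
  p * ((c%:A)%:P * q) = (c%:A)%:P * (p * q).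
Proof. by rewrite mulrA comm_scalar mulrA. Qed.

(** The Laurent identity (x^-3 Phi)' = x^-4 (x Phi' - 3 Phi), for Phi = x^3 p. *)
Lemma deriv_X3M (p : {poly A}) :
  'X * ('X^3 * p)^`() - ('X^3 * p) *+ 3 = 'X^4 * p^`().
Proof.
rewrite derivM derivXn mulrDr mulrnAl mulrnAr (mulrA _ 'X^2) (mulrA _ 'X^3).
rewrite -!exprS.
by rewrite addrAC subrr add0r.
Qed.

Section Conjugation.
Variables T Ts : {poly A}.
Hypothesis T_mon : T \is monic.
Hypothesis dT : T^`() = 1.
Hypothesis TTs : T * Ts = 'X^3.

Lemma mul_Ts_T : Ts * T = 'X^3.
Proof. by apply: (monic_lreg T_mon); rewrite mulrA TTs commXn. Qed.

(** This is (T^-1)' = - T^-2 with denominators cleared. *)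
Lemma sqr_Ts : Ts * Ts = 'X^2 * Ts *+ 3 - 'X^3 * Ts^`().
Proof.
have /(congr1 (fun p => Ts * p^`())) := TTs.
rewrite derivM dT mul1r derivXn mulrDr mulrA mul_Ts_T mulrnAr commXn.
by move=> <-; rewrite addrK.
Qed.

(** Up to the factor - x^3, the covariant derivative theta' + [theta, T^-1],
    which is T phi' T^-1 for phi = T^-1 theta T; here Ts = x^3 T^-1. *)
Definition cov_deriv (th : {poly A}) := Ts * th - th * Ts - 'X^3 * th^`().

(** This is - x^6 phi' T^-1: its coefficients below x^6 are the polar part of
    the right-hand side of delta' + z delta = - phi' T^-1. *)
Definition polar_poly (th : {poly A}) := Ts * cov_deriv th.

(** The hypothesis is the intertwining equation for beta = theta + gamma. With
    delta = T^-1 gamma = x^-3 D, the conclusion says that the right-hand side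
    of the conjugated equation is delta' + z delta. *)
Lemma polar_poly_total_deriv (th ga : {poly A}) (z : F) :
  'X^3 * (ga^`() + (z%:A)%:P * ga) - Ts * ga
    = cov_deriv th ->
  let D := Ts * ga in
  polar_poly th = 'X^2 * ('X * D^`() - D *+ 3 + (z%:A)%:P * ('X * D)).
Proof.
move=> E D; rewrite /polar_poly -E /D.
rewrite mulrBr [Ts * (Ts * ga)]mulrA sqr_Ts (mulXnCA 3) derivM.
rewrite mulrBl mulrnAl !mulrDr !mulrN (mul_scalarCA z Ts) -!mulrA.
rewrite !(mul_scalarCA z 'X) !mulrnAr opprB.
by rewrite [LHS](AC (2 * 2) (3 * 1 * 4 * 2)).
Qed.

(** Here Phi = x^3 phi, so that the right-hand side is - x^6 phi'. *)
Lemma polar_poly_conj (th : {poly A}) (Phi := Ts * th * T) :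
  polar_poly th * T = - ('X^2 * ('X * Phi^`() - Phi *+ 3)).
Proof.
have -> : polar_poly th * T
    = 'X^2 * Ts * th * T *+ 3 - 'X^3 * Ts^`() * th * T - 'X^3 * (Ts * th)
      - 'X^3 * (Ts * th^`() * T).
  rewrite /polar_poly /cov_deriv !mulrBr [Ts * (Ts * th)]mulrA sqr_Ts (mulXnCA 3).
  rewrite !mulrBl !mulrnAl -!mulrA mul_Ts_T.
  by rewrite commXn (mulXnCA 3 Ts th) -!mulrA.
rewrite /Phi !derivM dT mulr1 mulrBr mulrnAr opprB !mulrDl !mulrDr !mulrA.
by rewrite -exprSr addrAC -!addrA -!opprD !addrA.
Qed.

(** The condition that both T^-1 theta T and (T^-1 theta T)' T^-1 are
    polynomials, in a form that does not invert T. *)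
Definition tame (th : {poly A}) :=
  exists phi q, th * T = T * phi /\ phi^`() = q * T.

Lemma tame1 : tame 1.
Proof. by exists 1, 0; rewrite mul1r mulr1 mul0r -polyC1 derivC. Qed.

Lemma tame_linear (c : F) th eta : tame th -> tame eta ->
  tame ((c%:A)%:P * th + eta).
Proof.
move=> [phi [q [E1 E2]]] [phi' [q' [E1' E2']]].
exists ((c%:A)%:P * phi + phi'), ((c%:A)%:P * q + q'); split.
  by rewrite mulrDl mulrDr -mulrA E1 E1' mul_scalarCA.
by rewrite derivD derivM derivC mul0r add0r E2 E2' mulrDl mulrA.
Qed.

(** The factor theta2 arises by moving T to the right:
    phi1' phi2 = q1 T phi2 = q1 theta2 T. *)
Lemma tameM th eta : tame th -> tame eta -> tame (th * eta).
Proof.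
move=> [phi [q [E1 E2]]] [phi' [q' [E1' E2']]].
exists (phi * phi'), (q * eta + phi * q'); split.
  by rewrite -mulrA E1' !mulrA E1.
by rewrite derivM E2 E2' mulrDl -!mulrA E1'.
Qed.

Lemma tame_polar_poly th : tame th -> take_poly 6 (polar_poly th) = 0.
Proof.
move=> [phi [q [E1 E2]]]; apply/eqP/take_poly_eq0P; exists (- q).
apply: (monic_rreg T_mon); rewrite polar_poly_conj -mulrA E1 mulrA mul_Ts_T.
by rewrite deriv_X3M mulrA -exprD E2 mulrN mulNr mulrA.
Qed.

(** If phi' = - G T has no pole, then phi has none either: differentiation
    multiplies the coefficient of x^(i-3) in phi by i - 3, which is not zero
    for i < 3. *)
Lemma polar_poly_tame th : take_poly 6 (polar_poly th) = 0 -> tame th.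
Proof.
move=> /eqP/take_poly_eq0P[G HG].
have := polar_poly_conj th; rewrite HG; set Phi := Ts * th * T => E.
have E4 : 'X * Phi^`() - Phi *+ 3 = - ('X^4 * (G * T)).
  apply: (@mulXn_inj 2); rewrite /= mulrN (mulrA 'X^2 'X^4) -exprD -[LHS]opprK -E.
  by rewrite mulrA.
have /take_poly_eq0P[phi Phi3] : take_poly 3 Phi == 0.
  apply/eqP/polyP => i; rewrite coef_take_poly coef0; case: ltnP => // i3.
  move/(congr1 (fun p : {poly A} => p`_i)): E4.
  have -> : ('X * Phi^`() - Phi *+ 3)`_i = (i%:R - 3%:R : F) *: Phi`_i.
    rewrite scalerBl !scaler_nat coefB coefXM coefMn coef_deriv.
    by case: i {i3} => // i.
  rewrite coefN coefXnM (leq_trans i3) // oppr0 => /eqP.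
  rewrite scaler_eq0 subr_eq0 eqr_nat; case/orP => [/eqP i3'|/eqP //].
  by rewrite i3' in i3.
exists phi, (- G); split.
  apply: (@mulXn_inj 3); rewrite /= -{1}TTs -(mulrA T) (mulrA Ts).
  by rewrite -/Phi Phi3 (mulXnCA 3 T).
apply: (@mulXn_inj 4) => /=.
by rewrite mulNr mulrN -E4 Phi3 deriv_X3M.
Qed.

(** Both sides are - x^3 times the covariant derivative of theta, which is
    T phi' T^-1 = T q. *)
Lemma cov_deriv_tame th phi q : th * T = T * phi -> phi^`() = q * T ->
  cov_deriv th = - ('X^3 * (T * q)).
Proof.
move=> E1 E2; rewrite /cov_deriv; apply: (monic_rreg T_mon).
have dE : th^`() * T = phi + T * phi^`() - th.
  by move/(congr1 deriv): E1; rewrite !derivM dT mul1r mulr1 => <-; rewrite addrK.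
rewrite !mulrBl -!(mulrA Ts) -(mulrA th) -(mulrA 'X^3) mul_Ts_T E1 mulrA mul_Ts_T.
rewrite dE E2 commXn !(mulrBr, mulrDr) mulNr opprB opprD !addrA.
by rewrite subrK [X in X - _]subrr sub0r !mulrA.
Qed.

(** For be(x) = \sum_j b_j x^j this is x^3 e^(-xz) (psi B - theta psi). *)
Definition intertwining (th be : {poly A}) (z : F) : {poly A} :=
  'X^3 * (be^`() + (z%:A)%:P * be) - Ts * be
    - th * ((z%:A)%:P * 'X^3 - Ts).

Lemma intertwiningE th be z : intertwining th be z =
  'X^3 * ((be - th)^`() + (z%:A)%:P * (be - th)) - Ts * (be - th)
  - cov_deriv th.
Proof.
rewrite /intertwining /cov_deriv derivB !(mulrBr, mulrDr).
rewrite (mul_scalarCA z th) commXn (mulXnCA 3 _ th).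
move: (_ * be^`()) (_ * (_ * be)) (Ts * be) (_ * th^`()) (_ * (_ * th)) => a b c d e.
move: (Ts * th) (th * Ts) => f g; rewrite !opprB.
rewrite [RHS](AC (2 * 2 * 2 * (1 * 2)) (1 * 3 * 6 * (8 * 4) * (7 * 2) * (5 * 9))).
by rewrite /= !subrr !addr0.
Qed.

(** The left-hand side is 3! times the residue at 0 of e^(xz) g, where g is the
    Laurent polynomial delta' + z delta; this residue vanishes because
    e^(xz) g is the derivative of e^(xz) delta. *)
Lemma intertwining_residue th be z : intertwining th be z = 0 ->
  (\poly_(i < 4) ((polar_poly th)`_(5 - i) *+ (6 %/ i`!))).[z%:A] = 0.
Proof.
rewrite intertwiningE => /eqP; rewrite subr_eq0 => /eqP /polar_poly_total_deriv /=.
set D := Ts * _ => HE.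
have cH i : (polar_poly th)`_i.+2 = (i%:R - 3%:R : F) *: D`_i
                           + z *: (if i is i'.+1 then D`_i' else 0).
  rewrite HE coefXnM /= subn2 /= coefD coefB coefXM coefMn coefCM coefXM coef_deriv.
  rewrite scalerBl !scaler_nat mulr_algl.
  by case: i => [|i] //=.
rewrite horner_poly !big_ord_recr big_ord0 /= add0r !cH.
rewrite [(6 %/ 0`!)%N]/= [(6 %/ 1`!)%N]/= [(6 %/ 2`!)%N]/= [(6 %/ 3`!)%N]/=.
have Ez (v : A) n k : v *+ n * z%:A ^+ k = (n%:R * z ^+ k) *: v.
  by rewrite exprZn expr1n mulr_algr -scaler_nat scalerA mulrC.
rewrite !Ez !scalerDr !scalerA !scaler0.
rewrite addr0 [LHS](AC (2 * 2 * 2 * 1) (1 * (2 * 3) * (4 * 5) * (6 * 7))) /=.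
have [-> -> ->] : [/\ 6 %/ 1`! = 6, 6 %/ 2`! = 3 & 6 %/ 3`! = 1]%N by [].
rewrite -!scalerDl.
(* after this grouping the coefficient of each D`_i cancels *)
do ![rewrite [X in X *: _](_ : _ = 0) ?scale0r ?add0r; last by ring].
by [].
Qed.

(** The residue is a polynomial of degree at most 3 in z, so four values of z
    are enough. They give the vanishing of the coefficients of x^2, ..., x^5;
    those of 1 and x vanish because delta has a pole of order at most 3. *)
Lemma intertwining_tame th (be : F -> {poly A}) (zs : seq F) :
  uniq zs -> size zs = 4 -> (forall z, z \in zs -> intertwining th (be z) z = 0) ->
  tame th.
Proof.
move=> uzs szs zs0; apply: polar_poly_tame.
set p := (\poly_(i < 4) ((polar_poly th)`_(5 - i) *+ (6 %/ i`!))).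
have p0 : p = 0.
  apply: (@poly_scalar_roots_eq0 _ zs) => //; first by rewrite szs size_poly.
  by move=> z /zs0/intertwining_residue.
have pc i : (i < 4)%N -> (polar_poly th)`_(5 - i) = 0.
  move=> i4; move/(congr1 (fun p : {poly A} => p`_i)): p0.
  rewrite coef_poly i4 coef0 -scaler_nat => /eqP; rewrite scaler_eq0 pnatr_eq0.
  by case: i i4 => [|[|[|[]]]] //= _ /eqP.
have [z zz] : exists z, z \in zs.
  by case: zs szs {uzs zs0} => // z zs _; exists z; rewrite mem_head.
have := zs0 _ zz; rewrite intertwiningE => /eqP; rewrite subr_eq0.
move=> /eqP /polar_poly_total_deriv /= HE.
apply/polyP => i; rewrite coef_take_poly coef0; case: ltnP => // i6.
have [i2|i2] := ltnP i 2; first by rewrite HE coefXnM i2.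
by rewrite -(subKn (ltnSE i6)) pc // ltn_subLR // addnC.
Qed.

(** The inverse of d/dx + z is z^-1 \sum_l (- z^-1 d/dx)^l; the sum is finite on
    polynomials and the equation telescopes. *)
Lemma neumann_resolvent (q : {poly A}) (z : F) N : z != 0 -> q^`(N) = 0 ->
  let de := \sum_(l < N) ((-1) ^+ l.+1 / z ^+ l.+1)%:A%:P * q^`(l) in
  de^`() + (z%:A)%:P * de = - q.
Proof.
move=> z0 qN de; pose s l : {poly A} := ((-1) ^+ l / z ^+ l)%:A%:P * q^`(l).
have -> : de^`() + (z%:A)%:P * de = \sum_(l < N) (s l.+1 - s l).
  rewrite /de raddf_sum mulr_sumr -big_split; apply: eq_bigr => l _ /=.
  rewrite derivM derivC mul0r add0r /s derivnS; congr (_ + _).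
  rewrite mulrA -polyCM -scalerAl mul1r scalerA -mulNr -polyCN -scaleNr.
  by congr (_%:A%:P * _); rewrite !exprS; field; rewrite z0 expf_neq0.
rewrite -(big_mkord predT (fun l => s l.+1 - s l)) telescope_sumr //.
by rewrite /s qN mulr0 sub0r !expr0 divr1 scale1r mul1r derivn0.
Qed.

(** Substituting beta = theta + T delta leaves x^3 T (delta' + z delta + q). *)
Lemma tame_intertwining th phi q (de : {poly A}) (z : F) :
  th * T = T * phi -> phi^`() = q * T -> de^`() + (z%:A)%:P * de = - q ->
  intertwining th (th + T * de) z = 0.
Proof.
move=> E1 E2 Ede; rewrite intertwiningE (cov_deriv_tame E1 E2) opprK addrC.
rewrite [th + _]addrC addrK derivM dT mul1r (mulrA Ts) mul_Ts_T -(mul_scalarCA z T).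
rewrite -addrA -[T * _ + _]mulrDr Ede [_ * (de + _)]mulrDr addrAC subrr add0r.
by rewrite !mulrN subrr.
Qed.

End Conjugation.

Section Nilpotent.
Variable S : A.
Hypothesis S3 : S ^+ 3 = 0.
Definition Tlin : {poly A} := 'X + S%:P.
(** The polynomial x^3 T^-1. *)
Definition Tadj : {poly A} := 'X^2 - 'X * S%:P + (S ^+ 2)%:P.

Lemma Tlin_monic : Tlin \is monic.
Proof. by rewrite /Tlin -[S]opprK polyCN; apply: monicXsubC. Qed.

Lemma deriv_Tlin : Tlin^`() = 1.
Proof. by rewrite /Tlin derivD derivX derivC addr0. Qed.

Lemma mul_Tlin_Tadj : Tlin * Tadj = 'X^3.
Proof.
have XS : GRing.comm 'X (- S%:P) by apply: commr_sym; apply: commr_polyX.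
have S3P : (- S%:P) ^+ 3 = 0 :> {poly A}.
  by rewrite exprNn -polyC_exp S3 mulr0.
rewrite -['X^3]subr0 -S3P subrXX_comm // opprK; congr (_ * _).
rewrite !big_ord_recr big_ord0 /= add0r !expr0 !expr1 mulr1 mul1r sqrrN.
by rewrite /Tadj mulrN polyC_exp.
Qed.

Lemma horner_Tadj (x : F) : Tadj.[x%:A] = (x ^+ 2)%:A - x *: S + S ^+ 2.
Proof.
rewrite /Tadj !(hornerD, hornerN) hornerXn horner_scalarM hornerX !hornerC.
by rewrite exprZn expr1n -scalerAl mul1r.
Qed.

Lemma coef_Tlin_mul (u : {poly A}) k :
  (Tlin * u)`_k = (if k is k'.+1 then u`_k' else 0) + S * u`_k.
Proof. by rewrite mulrDl coefD coefXM coefCM; case: k. Qed.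

(** Expansion of T u' = (T u)' - T^-1 (T u) at x^k. The weights k, 1, -1 of this
    recurrence are the entries of the matrix mu. *)
Lemma Tlin_deriv_recurrence (u : {poly A}) k (w := Tlin * u) :
  w`_k.+1 *+ k + S * w`_k.+2 - S ^+ 2 * w`_k.+3 = (Tlin * u^`())`_k.
Proof.
have S3' : S * S * S = 0 by rewrite -S3 !exprS mulr1 mulrA.
rewrite /w !coef_Tlin_mul !mulrDr expr2 !mulrA S3' mul0r addr0 [_ + (_ + _)]addrA addrK.
rewrite mulrnDl -addrA -mulrSr.
rewrite !coef_deriv mulrnAr; congr (_ + _).
by case: k => // k; rewrite coef_deriv.
Qed.

(** Differentiation lowers the degree of T u by one at each step, since by
    [Tlin_deriv_recurrence] the coefficient k of T u' depends on later
    coefficients of T u only. *)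
Lemma Tlin_derivn_high (u : {poly A}) M : (forall k, (M <= k)%N -> (Tlin * u)`_k = 0) ->
  forall l k, (M <= k + l)%N -> (Tlin * u^`(l))`_k = 0.
Proof.
move=> u0; elim=> [|l IH] k Mkl; first by rewrite derivn0 u0 // -[k]addn0.
rewrite derivnS -Tlin_deriv_recurrence !IH ?mul0rn ?mulr0 ?addr0 ?subr0 //; lia.
Qed.

Lemma Tlin_derivn_eq0 (u : {poly A}) M : (forall k, (M <= k)%N -> (Tlin * u)`_k = 0) ->
  u^`(M) = 0.
Proof.
move=> u0; apply: (monic_lreg Tlin_monic); rewrite mulr0; apply/polyP => k.
by rewrite coef0 (Tlin_derivn_high u0) // leq_addl.
Qed.

Lemma coef_Tadj_mul (u : {poly A}) k : (Tadj * u)`_k =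
  (if k is k'.+2 then u`_k' else 0) - S * (if k is k'.+1 then u`_k' else 0)
  + S ^+ 2 * u`_k.
Proof.
rewrite /Tadj mulrDl mulrBl !coefD coefN coefXnM -(mulrA 'X) coefXM coefCM coefCM.
by case: k => [|[|k]]; rewrite ?mulr0 ?subSS ?subn0 //=.
Qed.

Lemma coef_mul_Tadj (u : {poly A}) k : (u * Tadj)`_k =
  (if k is k'.+2 then u`_k' else 0) - (if k is k'.+1 then u`_k' else 0) * S
  + u`_k * S ^+ 2.
Proof.
rewrite /Tadj mulrDr mulrBr !coefD coefN coefMXn mulrA !coefMC coefMX.
by case: k => [|[|k]]; rewrite ?mul0r ?subSS ?subn0 //=.
Qed.

(** The coefficients of x^i in [polar_poly], i < 6, are w_(i-2) - S w_(i-1)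
    + S^2 w_i. The one for i = 5 implies S w_3 = S^2 w_4 and S^2 w_3 = 0, and
    then those for i = 4, 3, 2 say w_2 = 0, w_1 = 0 and w_0 = 0 in turn. *)
Lemma tameP (th : {poly A}) (w := cov_deriv Tadj th) :
  tame Tlin th <->
  [/\ w`_0 = 0, w`_1 = 0, w`_2 = 0 & w`_3 - S * w`_4 + S ^+ 2 * w`_5 = 0].
Proof.
have SA x : S * (S ^+ 2 * x) = 0 by rewrite mulrA -exprS S3 mul0r.
have SB x : S ^+ 2 * (S * x) = 0 by rewrite mulrA -exprSr S3 mul0r.
have SC x : S ^+ 2 * (S ^+ 2 * x) = 0 by rewrite {1}expr2 -mulrA SA mulr0.
have HK : tame Tlin th <-> take_poly 6 (polar_poly Tadj th) = 0.
  split; [apply: tame_polar_poly|apply: polar_poly_tame] => //;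
  by [apply: Tlin_monic|apply: deriv_Tlin|apply: mul_Tlin_Tadj].
have hE k : (polar_poly Tadj th)`_k = (if k is k'.+2 then w`_k' else 0)
       - S * (if k is k'.+1 then w`_k' else 0) + S ^+ 2 * w`_k.
  exact: coef_Tadj_mul.
split=> [/HK h0|[w0 w1 w2 w3]].
  have h k : (k < 6)%N -> (polar_poly Tadj th)`_k = 0.
    move=> k6; move/(congr1 (fun p : {poly A} => p`_k)): h0.
    by rewrite coef_take_poly k6 coef0.
  have h2 := h 2 isT; have h3 := h 3 isT; have h4 := h 4 isT; have h5 := h 5 isT.
  rewrite !hE /= in h2 h3 h4 h5.
  have w2 : w`_2 = 0.
    move: h4; rewrite -addrA.
    move/(congr1 (fun x => S * x)): h5; rewrite mulr0 mulrDr mulrBr SA addr0.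
    rewrite (mulrA S) -expr2 => /eqP.
    by rewrite subr_eq0 => /eqP ->; rewrite addNr addr0.
  have w1 : w`_1 = 0.
    move: h3; rewrite w2 mulr0 subr0.
    move/(congr1 (fun x => S ^+ 2 * x)): h5; rewrite mulr0 mulrDr mulrBr.
    by rewrite SB SC subr0 addr0 => ->; rewrite addr0.
  by split=> //; move: h2; rewrite w1 w2 !mulr0 subr0 addr0.
apply/HK/polyP => k; rewrite coef_take_poly coef0 hE.
case: k => [|[|[|[|[|[|]]]]]] //=; rewrite ?w0 ?w1 ?w2 ?mulr0 ?subrr ?addr0 ?add0r //.
- have /(congr1 (fun x => S ^+ 2 * x)) := w3; rewrite mulr0 mulrDr mulrBr.
  by rewrite SB SC subr0 addr0 => ->.
- have /(congr1 (fun x => S * x)) := w3; rewrite mulr0 mulrDr mulrBr SA addr0.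
  rewrite (mulrA S) -expr2 => /eqP.
  by rewrite subr_eq0 => /eqP ->; rewrite ?sub0r addNr.
Qed.

End Nilpotent.
End Algebra.

(** * Complex derivatives of the wave function *)

(** The chain rule over any field of scalars, in particular for complex
    derivatives. *)
Lemma is_derive1_chain (K : numFieldType) (f g : K -> K) (x df dg : K) :
  is_derive x (1 : K) f df -> is_derive (f x) (1 : K) g dg ->
  is_derive x (1 : K) (g \o f) (dg * df).
Proof.
move=> [fd <-] [gd <-].
have [/derivable1_diffP fd' /derivable1_diffP gd'] := (fd, gd).
apply: DeriveDef; first exact/derivable1_diffP/differentiable_comp.
rewrite -!derive1E derive1E'; last exact/differentiable_comp.
rewrite diff_comp // !derive1E' //= -[X in 'd  _ _ X = _]mulr1.
by rewrite [LHS]linearZ mulrC.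
Qed.

Section Bispectral.
Variable R : realType.
Local Notation C := (CC R).
Local Notation M3 := 'M[C]_3.
Local Notation S := (Smx R).
Local Notation nabla th := (cov_deriv (Tadj S) th).

Lemma first_order_bound (f : R -> R) (df : R) : is_derive (0 : R) (1 : R) f df ->
  forall e : R, 0 < e -> exists2 d : R, 0 < d &
    forall x, `|x| < d -> `|f x - f 0 - df * x| <= e * `|x|.
Proof.
move=> [fd fdf] e e0.
have : (fun h : R => h^-1 *: (f (h *: 1 + 0) - f 0)) @ 0^' --> df.
  by rewrite -fdf; exact: fd.
move=> /cvgrPdist_le/(_ e e0).
rewrite near_withinE => /nbhs_ballP[d /= d0 H]; exists d => // x xd.
have [->|x0] := eqVneq x 0; first by rewrite subrr mulr0 subr0 normr0 mulr0.
have := H x; rewrite /ball/= sub0r normrN => /(_ xd x0).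
rewrite [_%:A]mulr1 addr0 => Hx.
have -> : f x - f 0 - df * x = - (df - x^-1 * (f x - f 0)) * x by field.
by rewrite normrM normrN ler_wpM2r.
Qed.

Lemma normc_le_ReIm (z : C) :
  `|z| <= (`|complex.Re z| + `|complex.Im z|)%:C%C :> C.
Proof.
rewrite {1}[z]complexE rmorphD /= (le_trans (ler_normD _ _)) // normrM.
have -> : `|'i%C| = 1 :> C by rewrite normc_def /= expr0n expr1n add0r sqrtr1.
by rewrite mul1r !normc_def /= !expr0n !addr0 !sqrtr_sqr.
Qed.

Lemma normc_ge_Im (z : C) : (`|complex.Im z|)%:C%C <= `|z| :> C.
Proof.
rewrite normc_def lecR -sqrtr_sqr ler_wsqrtr // lerDr; exact: sqr_ge0.
Qed.

Lemma cexpD (z w : C) : cexp (z + w) = cexp z * cexp w.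
Proof.
case: z w => [a b] [c d]; rewrite /cexp /= expRD cosD sinD.
by apply/eqP; rewrite eq_complex /=; apply/andP; split; apply/eqP; ring.
Qed.

Lemma cexp0 : cexp 0 = 1 :> C.
Proof. by rewrite /cexp /= expR0 cos0 sin0 mulr1 mulr0. Qed.

Lemma cexp_neq0 (z : C) : cexp z != 0.
Proof.
apply/eqP => z0; have := cexpD z (- z); rewrite subrr cexp0 z0 mul0r => /eqP.
by rewrite oner_eq0.
Qed.

(** With h = a + i b, the real part of e^h - 1 - h is (e^a - 1 - a)
    + e^a (cos b - 1) and the imaginary part is e^a (sin b - b) + (e^a - 1) b,
    so first order expansions of the real functions are enough. *)
Lemma cexp_first_order (e : R) : 0 < e -> exists2 d : R, 0 < d &
  forall h : C, `|h| < d%:C%C -> `|cexp h - 1 - h| <= (e%:C)%C * `|h|.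
Proof.
(* the four terms are bounded by 1, 3, 3 and 2 times k |h|, so 12 k <= e is
   small enough *)
move=> e0; have [k [k0 k1 ke]] : exists k : R, [/\ 0 < k, k <= 1 & 12 * k <= e].
  exists (Num.min 1 (e / 12)); rewrite lt_min ltr01 divr_gt0 // ge_min lexx.
  by split=> //; rewrite mulrC -ler_pdivlMr // ge_min lexx orbT.
have [d1 d10 H1] := first_order_bound (is_derive_expR (0 : R)) k0.
have [d2 d20 H2] := first_order_bound (is_derive_cos (0 : R)) k0.
have [d3 d30 H3] := first_order_bound (is_derive_sin (0 : R)) k0.
pose d := Num.min (Num.min d1 d2) (Num.min d3 k).
exists d; first by rewrite !lt_min d10 d20 d30 k0.
move=> h hd.
set a := complex.Re h; set b := complex.Im h.
pose n := complex.Re `|h|.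
have hn : `|h| = n%:C%C by rewrite RRe_real // normr_real.
have an : `|a| <= n by rewrite -lecR -hn; exact: normc_ge_Re.
have bn : `|b| <= n by rewrite -lecR -hn; exact: normc_ge_Im.
have nd : n < d by rewrite -ltcR -hn.
move: nd; rewrite !lt_min => /andP[/andP[nd1 nd2] /andP[nd3 nk]].
have := H1 a (le_lt_trans an nd1); have := H2 b (le_lt_trans bn nd2).
have := H3 b (le_lt_trans bn nd3).
rewrite expR0 cos0 sin0 oppr0 mul0r !mul1r !subr0 addr0 => Hs Hc He.
have n0 : 0 <= n by exact: le_trans an.
have Hs' : `|sin b - b| <= k * n by apply: (le_trans Hs); rewrite ler_wpM2l // ltW.
have Hc' : `|cos b - 1| <= k * n by apply: (le_trans Hc); rewrite ler_wpM2l // ltW.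
have He' : `|expR a - 1 - a| <= k * n by apply: (le_trans He); rewrite ler_wpM2l // ltW.
have E1 : `|expR a - 1| <= 2 * n.
  have -> : expR a - 1 = (expR a - 1 - a) + a by ring.
  apply: (le_trans (ler_normD _ _)); nra.
have E2 : `|expR a| <= 3.
  have -> : expR a = (expR a - 1) + 1 by ring.
  apply: (le_trans (ler_normD _ _)); rewrite normr1; nra.
rewrite hn -rmorphM /=; apply: (le_trans (normc_le_ReIm _)); rewrite lecR.
have -> : complex.Re (cexp h - 1 - h) = (expR a - 1 - a) + expR a * (cos b - 1).
  by rewrite !raddfB /= -/a -/b; ring.
have -> : complex.Im (cexp h - 1 - h) = expR a * (sin b - b) + (expR a - 1) * b.
  by rewrite !raddfB /= -/a -/b; ring.
have F1 : `|expR a * (cos b - 1)| <= 3 * (k * n).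
  by rewrite normrM ler_pM.
have F2 : `|expR a * (sin b - b)| <= 3 * (k * n).
  by rewrite normrM ler_pM.
have F3 : `|(expR a - 1) * b| <= 2 * (k * n).
  rewrite normrM; apply: (le_trans (ler_pM _ _ E1 bn)) => //; nra.
have G1 := ler_normD (expR a - 1 - a) (expR a * (cos b - 1)).
have G2 := ler_normD (expR a * (sin b - b)) ((expR a - 1) * b).
have kn0 : 0 <= k * n by apply: mulr_ge0 => //; exact: ltW.
have : 12 * (k * n) <= e * n by rewrite mulrA ler_wpM2r.
lra.
Qed.

Lemma is_derive_cexp (z : C) : is_derive z (1 : C) (@cexp R) (cexp z).
Proof.
have E : (fun h : C => h^-1 *: (cexp (h *: 1 + z) - cexp z)) @ 0^' --> cexp z.
  apply/cvgrPdist_le => e e0.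
  have [er er0 ee] : exists2 er : R, 0 < er & e = er%:C%C.
    exists (complex.Re e).
      by move: e0; rewrite ltcE /= => /andP[].
    by apply/esym/RRe_real/gtr0_real.
  have nz : `|cexp z| = (complex.Re `|cexp z|)%:C%C by rewrite RRe_real // normr_real.
  have n0 : 0 < complex.Re `|cexp z| by rewrite -ltcR -nz normr_gt0 cexp_neq0.
  have [d d0 H] := cexp_first_order (divr_gt0 er0 n0).
  rewrite near_withinE; apply/nbhs_ballP; exists (d%:C%C) => /=; first by rewrite ltcR.
  move=> h; rewrite /ball /= sub0r normrN => hd h0.
  rewrite [_%:A]mulr1 cexpD.
  have -> : cexp z - h^-1 *: (cexp h * cexp z - cexp z)
     = - (cexp z * h^-1 * (cexp h - 1 - h)).
    by rewrite /GRing.scale /=; field.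
  rewrite normrN !normrM normfV.
  apply: (le_trans (ler_wpM2l _ (H h hd))); first by rewrite mulr_ge0 // invr_ge0.
  have c0 : `|cexp z| != 0 :> C by rewrite normr_eq0 cexp_neq0.
  have hn0 : `|h| != 0 :> C by rewrite normr_eq0.
  rewrite ee fmorph_div /= -nz; set c := `|cexp z| in c0 *.
  rewrite [X in X <= _](_ : _ = er%:C%C) //; field.
  by rewrite hn0 c0.
by apply: DeriveDef; [exact: cvgP E|exact: cvg_lim E].
Qed.

Lemma is_derive_cexpM (x z : C) :
  is_derive z (1 : C) (fun w => cexp (x * w)) (cexp (x * z) * x).
Proof.
apply: (@is_derive1_chain _ ( *%R x) (@cexp R)); last exact: is_derive_cexp.
by apply: is_derive_eq; rewrite [LHS]mulr1.
Qed.

Lemma is_derive_affine (a k z : C) :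
  is_derive z (1 : C) (fun w : C => a * w + k) a.
Proof.
have H := is_deriveD (is_deriveZ a (is_derive_id z (1 : C))) (is_derive_cst k z (1 : C)).
apply: (is_derive_eq H).
by rewrite addr0; exact: mulr1.
Qed.

Lemma derive1n_exp_affine (n : nat) (x p q z : C) :
  derive1n n (fun w => cexp (x * w) * (p * w + q)) z
  = cexp (x * z) * (x ^+ n * (p * z + q) + n%:R * x ^+ n.-1 * p).
Proof.
elim: n z => [|n IH] z; first by rewrite expr0 !mul0r addr0 mul1r.
rewrite derive1nS.
have -> : derive1n n (fun w => cexp (x * w) * (p * w + q))
   = (fun w => cexp (x * w)) * (fun w => x ^+ n * (p * w + q) + n%:R * x ^+ n.-1 * p).
  by apply/funext => w; rewrite IH.
rewrite derive1E.
have E1 := is_derive_cexpM x z.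
have E2 : is_derive z (1 : C)
    (fun w => x ^+ n * (p * w + q) + n%:R * x ^+ n.-1 * p) (x ^+ n * p).
  have -> : (fun w => x ^+ n * (p * w + q) + n%:R * x ^+ n.-1 * p)
    = (fun w => (x ^+ n * p) * w + (x ^+ n * q + n%:R * x ^+ n.-1 * p)).
    by apply/funext => w; rewrite mulrDr -addrA (mulrA (x ^+ n)).
  exact: is_derive_affine.
have alg (E r : C) : E * (x ^+ n * p) + (x ^+ n * r + n%:R * x ^+ n.-1 * p) * (E * x)
    = E * (x ^+ n.+1 * r + n.+1%:R * x ^+ n.+1.-1 * p).
  rewrite -natr1 -pred_Sn; case: (n) => [|m]; last by rewrite -pred_Sn !exprS; ring.
  by rewrite !mul0r !expr0 expr1; ring.
have [_ ->] := is_deriveM E1 E2.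
exact: alg.
Qed.
Lemma scalar_algE (x : C) : x%:A = x%:M :> M3.
Proof. by rewrite -scalemx1. Qed.

(** The last factor is z - T^-1, as x^-3 Tadj(x) = T(x)^-1. *)
Lemma psiE (x z : C) : x != 0 ->
  psi x z = cexp (x * z) *: (z%:A - x ^- 3 *: (Tadj S).[x%:A]).
Proof.
move=> x0; rewrite /psi; congr (_ *: _).
rewrite horner_Tadj scalerDr scalerBr !scalerA !scalar_algE.
have -> : x ^- 3 * x ^+ 2 = x^-1 by field.
have -> : x ^- 3 * x = x^-2 by field.
by rewrite opprD opprB !addrA [X in X - _ = _]addrAC.
Qed.

Lemma mx_deriven_psi (n : nat) (x z : C) : x != 0 ->
  mx_deriven n (psi x) z = cexp (x * z) *:
    (x ^+ n *: (z%:A - x ^- 3 *: (Tadj S).[x%:A]) + (n%:R * x ^+ n.-1)%:A).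
Proof.
move=> x0; set N := x ^- 3 *: _; apply/matrixP => i j; rewrite mxE.
have -> : (fun w => psi x w i j)
    = (fun w => cexp (x * w) * ((i == j)%:R * w + (- N) i j)).
  apply/funext => w; rewrite psiE // -/N [LHS]mxE; apply: (congr1 ( *%R _)).
  by rewrite [LHS]mxE scalar_algE mxE mulr_natl.
rewrite derive1n_exp_affine [RHS]mxE; apply: (congr1 ( *%R _)).
rewrite [RHS]mxE; apply: (f_equal2 +%R).
  rewrite [RHS]mxE; apply: (congr1 ( *%R _)).
  by rewrite [RHS]mxE scalar_algE [X in _ = X + _]mxE mulr_natl.
by rewrite scalar_algE mxE mulr_natr.
Qed.

(** This is e^(xz) (beta' + (z - T^-1) beta). *)
Lemma right_act_psi m b (x z : C) (be := \poly_(j < m.+1) b j z) : x != 0 ->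
  right_act m b (psi x) z = cexp (x * z) *:
    ((z%:A - x ^- 3 *: (Tadj S).[x%:A]) * be.[x%:A] + be^`().[x%:A]).
Proof.
move=> x0; rewrite /right_act /be poly_def raddf_sum !horner_sum mulr_sumr -big_split.
rewrite scaler_sumr; apply: eq_bigr => j _ /=.
rewrite mx_deriven_psi // -scalerAl mulrDl; congr (_ *: (_ + _)).
  by rewrite hornerZ hornerXn exprZn expr1n mulr_algr -scalerAl scalerAr.
rewrite derivZ derivXn hornerZ hornerMn hornerXn exprZn expr1n mulrnAr mulr_algr mulr_algl.
by rewrite -scalerA scaler_nat.
Qed.

(** Division by the exponential and by x^3 turns the bispectral equation into a
    polynomial identity in x. *)
Lemma bispectral_atE m b th (x z : C) : x != 0 ->
  bispectral_at m b th x z <->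
  (intertwining (Tadj S) th (\poly_(j < m.+1) b j z) z).[x%:A] = 0.
Proof.
move=> x0; rewrite /bispectral_at right_act_psi // psiE // -scalar_algE.
set be := \poly_(_ < _) _; set N := x ^- 3 *: _.
rewrite -scalerAr.
have -> : (intertwining (Tadj S) th be z).[x%:A]
  = x ^+ 3 *: (((z%:A - N) * be.[x%:A] + be^`().[x%:A]) - th.[x%:A] * (z%:A - N)).
  have TN : (Tadj S).[x%:A] = x ^+ 3 *: N by rewrite /N scalerA mulfV ?expf_neq0 // scale1r.
  move: (Tadj S) TN => Q TN.
  rewrite /intertwining !(hornerD, hornerN) (horner_scalarM 'X^3) (horner_scalarM Q).
  rewrite (horner_scalarM th) !(hornerD, hornerN) (horner_scalarM _ be).
  rewrite (horner_scalarM _ 'X^3) TN hornerC hornerXn exprZn expr1n.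
  rewrite (mulr_algl (x ^+ 3)) (mulr_algr (x ^+ 3)) -(scalerAl (x ^+ 3) N).
  rewrite -!scalerBr -scalerAr -scalerBr.
  by congr (_ *: (_ - _)); rewrite [in RHS]mulrBl [RHS]addrC addrA.
split=> [/(scalerI (cexp_neq0 _)) ->|]; first by rewrite subrr scaler0.
move=> /eqP; rewrite scaler_eq0 expf_eq0 (negbTE x0) /= subr_eq0 => /eqP ->.
by [].
Qed.

(** * Matrix entries and the algebra Gamma *)

(** Entries with natural number indices, so that multiplication by S is a shift
    of indices and concrete entries are found by computation. *)
Definition ent (M : M3) (i j : nat) : C := M (inord i) (inord j).

Lemma ent_eqP (M N : M3) :
  (forall i j, (i < 3)%N -> (j < 3)%N -> ent M i j = ent N i j) -> M = N.
Proof.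
move=> MN; apply/matrixP => i j.
by have := MN i j (ltn_ord i) (ltn_ord j); rewrite /ent !inord_val.
Qed.

Lemma ent0 i j : ent 0 i j = 0. Proof. by rewrite /ent mxE. Qed.
Lemma entD M N i j : ent (M + N) i j = ent M i j + ent N i j.
Proof. by rewrite /ent mxE. Qed.
Lemma entN M i j : ent (- M) i j = - ent M i j.
Proof. by rewrite /ent mxE. Qed.
Lemma entMn M n i j : ent (M *+ n) i j = ent M i j *+ n.
Proof. by elim: n => [|n IH]; rewrite ?mulr0n ?ent0 // !mulrS entD IH. Qed.
Lemma ent_mx3 rows i j : (i < 3)%N -> (j < 3)%N ->
  ent (mx3 rows) i j = (nth [::] rows i)`_j.
Proof. by move=> i3 j3; rewrite /ent mxE !inordK. Qed.

Lemma Smx_ent i j : (i < 3)%N -> (j < 3)%N -> ent S i j = (j == i.+1)%:R.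
Proof.
move=> i3 j3; rewrite ent_mx3 //.
by case: i i3 => [|[|[|]]] // _; case: j j3 => [|[|[|]]].
Qed.

Lemma entM M N i j : ent (M * N) i j = \sum_(k < 3) ent M i k * ent N k j.
Proof. by rewrite /ent mxE; apply: eq_bigr => k _; rewrite inord_val. Qed.

Lemma ent_SM M i j : (i < 3)%N -> (j < 3)%N ->
  ent (S * M) i j = if (i < 2)%N then ent M i.+1 j else 0.
Proof.
move=> i3 j3; rewrite entM !big_ord_recr big_ord0 /= !Smx_ent //.
by case: i i3 => [|[|[|]]] //= _; rewrite ?mul0r ?mul1r ?add0r ?addr0.
Qed.

Lemma ent_MS M i j : (i < 3)%N -> (j < 3)%N ->
  ent (M * S) i j = if j is j'.+1 then ent M i j' else 0.
Proof.
move=> i3 j3; rewrite entM !big_ord_recr big_ord0 /= !Smx_ent //.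
by case: j j3 => [|[|[|]]] //= _; rewrite ?mulr0 ?mulr1 ?add0r ?addr0.
Qed.

Lemma Smx3 : S ^+ 3 = 0.
Proof.
apply: ent_eqP => i j i3 j3; rewrite ent0 !exprS expr0 mulr1 ent_SM //.
by case: i i3 => [|[|[|]]] //= _; rewrite ?ent_SM //= ?Smx_ent //=; case: j j3 => [|[|[|]]].
Qed.

Definition Gamma_coef (r : nat -> nat -> nat -> C) (k : nat) : M3 :=
  nth 0 [::
  mx3 [:: [:: r 0 1 1; r 0 1 2; r 0 1 3];
           [:: 0;       r 0 2 2; r 0 2 3];
           [:: 0;       0;       r 0 1 1]];
  mx3 [:: [:: r 1 1 1; r 1 1 2; r 1 1 3];
             [:: r 0 2 2 - r 0 1 1; r 1 2 2; r 1 2 3];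
             [:: 0; r 0 2 2 - r 0 1 1; r 1 1 1 + r 0 2 3 - r 0 1 2]];
  mx3 [:: [:: r 2 1 1; r 2 1 2; r 2 1 3];
             [:: r 1 2 2 - r 1 1 1 - r 0 2 3 + r 0 1 2; r 2 2 2; r 2 2 3];
             [:: r 0 2 2 - r 0 1 1; r 1 2 2 - r 1 1 1;
                 r 2 1 1 + r 1 2 3 - r 1 1 2]];
  mx3 [:: [:: r 3 1 1; r 3 1 2; r 3 1 3];
             [:: r 3 2 1; r 3 2 2; r 3 2 3];
             [:: r 1 2 2 - 2 * r 1 1 1 - r 0 2 3 + r 0 1 2;
                 r 3 3 2; r 3 3 3]];
  mx3 [:: [:: r 4 1 1; r 4 1 2; r 4 1 3];
             [:: r 4 2 1; r 4 2 2; r 4 2 3];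
             [:: r 3 3 2 + r 3 2 1 - r 2 2 2 - r 2 1 1 + r 1 1 2;
                 r 4 3 2; r 4 3 3]];
  mx3 [:: [:: r 5 1 1; r 5 1 2; r 5 1 3];
             [:: r 5 2 1; r 5 2 2; r 5 2 3];
             [:: r 4 3 2 + r 4 2 1 - r 3 3 3 - r 3 2 2 - r 3 1 1
                 + r 2 2 3 + r 2 1 2 - r 1 1 3;
                 r 5 3 2; r 5 3 3]] ] k.

Lemma Gamma_polyE r p :
  Gamma_poly r p = \poly_(k < 6) Gamma_coef r k + 'X^6 * p.
Proof.
rewrite poly_def /Gamma_poly !big_ord_recr big_ord0 /= add0r.
by rewrite -!mul_polyC expr0 mulr1 expr1.
Qed.

Lemma GammaP th :
  Gamma th <-> exists r, forall k, (k < 6)%N -> th`_k = Gamma_coef r k.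
Proof.
split=> [[r [p ->]]|[r thr]].
  by exists r => k k6; rewrite Gamma_polyE coefD coef_poly coefXnM k6 addr0.
exists r, (drop_poly 6 th); rewrite Gamma_polyE -commr_polyXn.
rewrite -{1}(poly_take_drop 6 th); congr (_ + _); apply/polyP => k.
by rewrite coef_take_poly coef_poly; case: ltnP => // /thr.
Qed.

(** The entry (i, j) of the n-th coefficient S^2 a_n - a_n S^2
    - (S a_(n-1) - a_(n-1) S) - (n - 2) a_(n-2) of [cov_deriv], where a n i j
    are the entries of the coefficients of theta. *)
Definition cov_entry (a : nat -> nat -> nat -> C) (n i j : nat) : C :=
  (if (i < 1)%N then a n i.+2 j else 0) - (if j is j'.+2 then a n i j' else 0)
  - (if n is n'.+1 then
      (if (i < 2)%N then a n' i.+1 j else 0) - (if j is j'.+1 then a n' i j' else 0)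
     else 0)
  - (if n is n'.+3 then a n'.+1 i j *+ n'.+1 else 0).

Lemma ent_S2M M i j : (i < 3)%N -> (j < 3)%N ->
  ent (S ^+ 2 * M) i j = if (i < 1)%N then ent M i.+2 j else 0.
Proof.
move=> i3 j3; rewrite expr2 -mulrA ent_SM //.
by case: i i3 => [|[|[|]]] // _; rewrite ?ent_SM //=.
Qed.

Lemma ent_MS2 M i j : (i < 3)%N -> (j < 3)%N ->
  ent (M * S ^+ 2) i j = if j is j'.+2 then ent M i j' else 0.
Proof.
move=> i3 j3; rewrite expr2 mulrA ent_MS //.
by case: j j3 => [|[|[|]]] // _; rewrite ?ent_MS //=.
Qed.

Lemma ent_cov_deriv th n i j : (i < 3)%N -> (j < 3)%N ->
  ent (nabla th)`_n i j = cov_entry (fun k => ent th`_k) n i j.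
Proof.
have E (a s1 s2 r1 r2 d : C) :
  a - s1 + s2 - (a - r1 + r2) - d = s2 - r2 - (s1 - r1) - d.
  by ring.
move=> i3 j3; rewrite /cov_deriv !coefB coef_Tadj_mul coef_mul_Tadj coefXnM coef_deriv.
rewrite !(entD, entN) ent_S2M // ent_MS2 // ent_SM // ent_MS // E /cov_entry.
congr (_ - _ - _).
  by case: n => //=; rewrite ent0 if_same; case: (j) => [|j']; rewrite ?ent0 subrr.
by case: n => [|[|[|n]]]; rewrite ?ent0 //= entMn !subSS subn0.
Qed.

(** The equations of [tameP] are 36 linear equations on the entries of the first
    six coefficients. They have rank 15 and express the 15 entries which
    are not free in the definition of Gamma through the others. *)
Lemma Gamma_tame th : Gamma th <-> tame (Tlin S) th.
Proof.
rewrite GammaP (tameP Smx3).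
have wE n i j : (i < 3)%N -> (j < 3)%N ->
    ent (nabla th)`_n i j = cov_entry (fun k => ent th`_k) n i j.
  exact: ent_cov_deriv.
split=> [[r thr]|[w0 w1 w2 w3]].
  have thE k i j : (k < 6)%N -> ent th`_k i j = ent (Gamma_coef r k) i j.
    by move=> /thr ->.
  { split; apply: ent_eqP => i j i3 j3; rewrite ?entD ?entN ?ent_SM ?ent_S2M ?ent0 //.
  all: case: i i3 => [|[|[|]]] // _; rewrite /=.
  all: case: j j3 => [|[|[|]]] // _; rewrite ?wE ?ent0 // /cov_entry /=.
  all: rewrite ?thE // /= ?ent_mx3 //=.
  all: by ring. }
pose a k i j := ent th`_k i j.
exists (fun k i j => a k i.-1 j.-1).
have e0 n i j : (n < 3)%N -> (i < 3)%N -> (j < 3)%N -> cov_entry a n i j = 0.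
  move=> n3 i3 j3; rewrite -wE //.
  by case: n n3 => [|[|[|]]] // _; rewrite ?w0 ?w1 ?w2 ent0.
pose L j := cov_entry a 3 0 j - cov_entry a 4 1 j + cov_entry a 5 2 j.
have e3 j : (j < 3)%N -> L j = 0.
  move=> j3; rewrite /L; have := congr1 (fun M => ent M 0 j) w3.
  by rewrite !entD entN ent_SM // ent_S2M // ent0 /= !wE.
have sub0 (x y u : C) : u = 0 -> x - y = u -> x = y.
  by move=> -> /eqP; rewrite subr_eq0 => /eqP.
move=> k k6; apply: ent_eqP => i j i3 j3; rewrite -/(a k i j).
case: k k6 => [|[|[|[|[|[|]]]]]] // _; rewrite ent_mx3 //.
all: case: i i3 => [|[|[|]]] // _; case: j j3 => [|[|[|]]] // _; rewrite /=; try by [].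
(* each missing equation is a combination of the given ones, whose multipliers
   come from solving the linear system *)
all: [> apply: (sub0 _ _ (- cov_entry a 0 1 2))
 | apply: (sub0 _ _ (cov_entry a 0 0 0))
 | apply: (sub0 _ _ (cov_entry a 0 0 1))
 | apply: (sub0 _ _ (cov_entry a 0 0 2))
 | apply: (sub0 _ _ (- cov_entry a 0 0 2 - cov_entry a 1 1 2))
 | apply: (sub0 _ _ (cov_entry a 1 0 0 - cov_entry a 0 1 2))
 | apply: (sub0 _ _ (cov_entry a 1 0 1))
 | apply: (sub0 _ _ (cov_entry a 1 0 2))
 | apply: (sub0 _ _ (- cov_entry a 1 0 2 - cov_entry a 2 1 2))
 | apply: (sub0 _ _ (cov_entry a 2 0 0 - cov_entry a 0 0 2 - cov_entry a 1 1 2))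
 | apply: (sub0 _ _ (cov_entry a 2 0 1))
 | apply: (sub0 _ _ (cov_entry a 2 0 2))
 | apply: (sub0 _ _ (- cov_entry a 1 0 2 - cov_entry a 2 1 2 - L 0))
 | apply: (sub0 _ _ (L 1))
 | apply: (sub0 _ _ (- L 2))].
all: first [by rewrite !(e0, e3) // ?oppr0 ?subr0 ?addr0
           |by rewrite /L /cov_entry /=; ring].
Qed.

(** * Bispectral polynomials are tame *)

Lemma nbhs_neq (w z : C) : w != z -> \forall v \near w, v != z.
Proof.
move=> wz; apply/nbhs_ballP; exists `|w - z|; first by rewrite /= normr_gt0 subr_eq0.
by move=> v; rewrite /ball /=; apply: contraTneq => ->; rewrite ltxx.
Qed.

(** Quotients of holomorphic functions by powers of w - z are holomorphic off z,
    so the poles of a meromorphic function are isolated. *)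
Lemma meromorphic_near (f : C -> C) (z : C) :
  meromorphic_at f z -> \forall w \near z^', holomorphic_at f w.
Proof.
move=> [n [g [/nbhs_interior gh]]].
rewrite !near_withinE => /nbhs_interior fg.
near=> w => wz.
have gw : \forall v \near w, derivable g v 1 by near: w.
have fw : \forall v \near w, v != z -> f v = g v / (v - z) ^+ n by near: w.
have nz : \forall v \near w, v != z.
  exact: nbhs_neq.
have fw' := nbhs_interior fw; have nz' := nbhs_interior nz.
rewrite /holomorphic_at; near=> v.
have vz : v != z by near: v.
have dg : derivable g v 1 by near: v.
have E : \forall u \near v, f u = g u / (u - z) ^+ n.
  have fv : \forall u \near v, u != z -> f u = g u / (u - z) ^+ n by near: v.
  have nv : \forall u \near v, u != z by near: v.
  by near=> u; apply: (near fv u) => //; near: u.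
apply: (@near_eq_derivable _ _ _ (fun u => g u / (u - z) ^+ n)).
  by near=> u; apply/esym; near: u.
have d1 : derivable (fun u : C => 1 * u + - z) v (1 : C).
  by case: (is_derive_affine 1 (- z) v).
have d2 : derivable (fun u : C => (1 * u - z) ^+ n) v 1.
  by have := derivableX (n := n) d1; rewrite exprfctE.
have nv : (1 * v - z) ^+ n != 0 by rewrite mul1r expf_neq0 // subr_eq0.
have d3 := @derivableV _ _ (fun u : C => (1 * u - z) ^+ n) v 1 nv d2.
have := derivableM dg d3.
rewrite [X in derivable X _ _](_ : _ = (fun u => g u / (u - z) ^+ n)) //.
by apply/funext => u; transitivity (g u / (1 * u - z) ^+ n); [|rewrite mul1r].
Unshelve. all: by end_near. Qed.

Lemma uniq_shifted_inv (z0 e : C) n : e != 0 ->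
  uniq [seq z0 + e / k.+2%:R | k <- iota 0 n].
Proof.
move=> e0; rewrite map_inj_uniq ?iota_uniq // => i j /addrI /(mulfI e0) /invr_inj /eqP.
by rewrite eqr_nat => /eqP [].
Qed.

(** Near a point of the domain all coefficients of the operator are holomorphic
    off that point, so there are four values of z for which the equation
    holds at every x <> 0, hence identically in x. *)
Lemma bisp_alg_tame th : bisp_alg th -> tame (Tlin S) th.
Proof.
move=> [U [m [b [[oU _ [z0 Uz0] bm] H]]]].
have : \forall w \near z0^', U w /\
     forall (j : 'I_m.+1) (i k : 'I_3), holomorphic_at (fun w => b j w i k) w.
  have A1 : \forall w \near z0^', U w.
    by apply: nbhs_dnbhs; exact: open_nbhs_nbhs.
  have A2 : \forall w \near z0^', forall (j : 'I_m.+1) (i k : 'I_3),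
      holomorphic_at (fun w => b j w i k) w.
    apply: filter_forall => j; apply: filter_forall => i; apply: filter_forall => k.
    by apply: meromorphic_near; apply: bm => //; rewrite -ltnS.
  exact: filterI A1 A2.
rewrite near_withinE => /nbhs_ballP[e /= e0 good].
pose zs := [seq z0 + e / k.+2%:R | k <- iota 0 4].
apply: (@intertwining_tame _ _ _ _ (Tlin_monic S) (deriv_Tlin S) (mul_Tlin_Tadj Smx3) th
          (fun z => \poly_(j < m.+1) b j z) zs).
- exact/uniq_shifted_inv/lt0r_neq0.
- by [].
move=> _ /mapP[k _ ->]; set z := z0 + _.
have kC : (0 : C) < k.+2%:R by rewrite ltr0n.
have [Uz bz] : U z /\ forall (j : 'I_m.+1) (i k : 'I_3),
    holomorphic_at (fun w => b j w i k) z.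
  apply: (good z).
    rewrite /ball /= /z opprD addrA subrr sub0r normrN gtr0_norm ?divr_gt0 //.
    by rewrite ltr_pdivrMr // ltr_pMr // ltr1n.
  by rewrite /z -subr_eq0 addrC addKr mulf_neq0 ?invr_eq0 ?lt0r_neq0.
set p := intertwining _ _ _ _.
apply: (@poly_scalar_roots_eq0 _ _ p [seq k.+1%:R | k <- iota 0 (size p)]).
- rewrite map_inj_uniq ?iota_uniq // => i j /eqP.
  by rewrite eqr_nat => /eqP [].
- by rewrite size_map size_iota.
move=> _ /mapP[i _ ->]; have i0 : i.+1%:R != 0 :> C by rewrite pnatr_eq0.
apply/(bispectral_atE _ _ _ _ i0)/H => // j jm i' k'.
exact: (bz (Ordinal (jm : (j < m.+1)%N))).
Qed.

(** * The explicit operator *)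

Lemma Pmap_cov_deriv k (th : {poly M3}) : Pmap k th = - (nabla th)`_(k.+3).
Proof.
have taylor n : (th^`(n)).[0] = n`!%:R *: th`_n.
  by rewrite horner_coef0 coef_derivn addn0 ffactnn scaler_nat.
have fact_neq0 n : n`!%:R != 0 :> C by rewrite pnatr_eq0 -lt0n fact_gt0.
rewrite /Pmap !taylor big_nat_recr // big_nat1 !taylor !scalerA !mulVf // !scale1r.
rewrite factS natrM mulrCA mulVf // mulr1 scaler_nat.
have [-> ->] : (k.+2 - k = 2 /\ k.+3 - k = 3)%N by lia.
have -> : (-1) ^+ 2 = 1 :> C by rewrite expr2 mulrNN mulr1.
have -> : (-1) ^+ 3 = -1 :> C by rewrite exprS expr2 mulrNN !mulr1.
rewrite scaleN1r scale1r /bracket expr1.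
rewrite /cov_deriv !coefB coef_Tadj_mul coef_mul_Tadj coefXnM coef_deriv.
have E (a b c d e p : M3) :
    p - (d - b + - (e - c)) = - (a - b + c - (a - d + e) - p).
  rewrite [RHS]opprB -[LHS]/(p + - (d - b - (e - c))) opprB [in RHS]opprB.
  rewrite opprB opprD opprB.
  rewrite [X in _ = _ + X](AC (3 * (2 * 1)) (1 * 5 * (3 * 6 * (4 * 2)))) /=.
  by rewrite subrr add0r.
by rewrite !subSS !subn0; exact: E.
Qed.

Lemma coef_Tlin_Pmap th phi q : th * Tlin S = Tlin S * phi -> phi^`() = q * Tlin S ->
  forall k, (Tlin S * q)`_k = Pmap k th.
Proof.
move=> E1 E2 k; rewrite Pmap_cov_deriv.
rewrite (cov_deriv_tame (Tlin_monic S) (deriv_Tlin S) (mul_Tlin_Tadj Smx3) E1 E2).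
by rewrite coefN opprK coefXnM /= !subSS subn0.
Qed.

Section Formula.
Variable M : nat.

Definition mu_band (j s : nat) : C :=
  if s == j.+1 then j%:R else if s == j.+2 then 1 else if s == j.+3 then -1 else 0.

Lemma mu_mxE (j s : 'I_M.+1) : mu_mx R M j s = mu_band j s.
Proof.
rewrite mxE /mu_band leq_min; have sM : (s <= M)%N by rewrite -ltnS.
rewrite sM andbT.
have [->|js] := eqVneq (s : nat) j.+1; first by rewrite ltnn.
have [->|js2] := eqVneq (s : nat) j.+2.
  by rewrite leqnn leqnSn /= -[j.+2]addn2 addKn expr2 mulrNN mulr1.
have [->|js3] := eqVneq (s : nat) j.+3.
  by rewrite leqnn leqnSn /= -[j.+3]addn3 addKn exprS expr2 mulrNN !mulr1.
case: ifP => // /andP[]; lia.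
Qed.

Lemma mu_band_eq0 j s : (s <= j)%N || (j.+3 < s)%N -> mu_band j s = 0.
Proof. by rewrite /mu_band => H; do ![case: eqP => [?|_]; first by lia]. Qed.

(** mu is strictly upper triangular. *)
Lemma mu_exp_eq0 l (j r : 'I_M.+1) : (r < j + l)%N -> (mu_mx R M ^+ l) j r = 0.
Proof.
elim: l j => [|l IH] j rjl.
  by rewrite expr0 mxE; case: eqP => // E; move: rjl; rewrite E addn0 ltnn.
rewrite exprS mxE big1 // => s _; rewrite mu_mxE.
have [sj|js] := leqP s j; first by rewrite mu_band_eq0 ?sj ?mul0r.
by rewrite IH ?mulr0 //; lia.
Qed.

Lemma sum_three_diagonals (V : zmodType) (f : nat -> V) j N :
  (forall s, (s <= j)%N || (j.+3 < s)%N -> f s = 0) ->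
  (forall s, (N <= s)%N -> f s = 0) ->
  \sum_(s < N) f s = f j.+1 + f j.+2 + f j.+3.
Proof.
move=> fj fN; have ext K : (N <= K)%N -> \sum_(s < N) f s = \sum_(0 <= s < K) f s.
  move=> NK; rewrite (@big_cat_nat _ _ _ N) //= big_mkord.
  have -> : \sum_(N <= s < K) f s = 0; last by rewrite addr0.
  by rewrite big_nat big1 // => s /andP[Ns _]; apply: fN.
rewrite (ext (maxn N j.+4)) ?leq_maxl // (@big_cat_nat _ _ _ j.+4) ?leq_maxr //=.
have -> : \sum_(j.+4 <= s < maxn N j.+4) f s = 0.
  by rewrite big_nat big1 // => s /andP[js _]; apply: fj; rewrite js orbT.
rewrite addr0; do 3 rewrite big_nat_recr //=.
have -> : \sum_(0 <= s < j.+1) f s = 0; last by rewrite add0r.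
by rewrite big_nat big1 // => s /andP[_ sj]; apply: fj; rewrite -ltnS sj.
Qed.

(** Induction on l: left multiplication by mu is [Tlin_deriv_recurrence]. The
    powers of S add up because a nonzero entry (mu^l)_jr has r >= j + l, which
    also excludes truncation in the exponent. *)
Lemma mu_powers (u : {poly M3}) : (forall k, (M <= k)%N -> (Tlin S * u)`_k = 0) ->
  forall l (j : 'I_M.+1),
  \sum_(r < M.+1) (mu_mx R M ^+ l) j r *: (S ^+ (r - j - l) * (Tlin S * u)`_r)
  = (Tlin S * u^`(l))`_j.
Proof.
move=> u0; elim=> [|l IH] j.
  rewrite (bigD1 j) //= expr0 mxE eqxx scale1r subnn expr0 mul1r ?derivn0.
  by rewrite big1 ?addr0 // => r rj; rewrite mxE eq_sym (negbTE rj) scale0r.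
transitivity (\sum_(s < M.+1) mu_band j s *: (S ^+ (s - j.+1) * (Tlin S * u^`(l))`_s)).
  under eq_bigr => r _ do rewrite exprS mxE scaler_suml.
  rewrite exchange_big; apply: eq_bigr => s _ /=.
  rewrite -IH mulr_sumr scaler_sumr; apply: eq_bigr => r _.
  rewrite mu_mxE -scalerA.
  have [sj|js] := leqP s j; first by rewrite mu_band_eq0 ?sj ?scale0r.
  have [rs|sr] := ltnP r (s + l); first by rewrite mu_exp_eq0 // !(scale0r, mulr0).
  rewrite -scalerAr mulrA -exprD; congr (_ *: (_ *: (S ^+ _ * _))); lia.
rewrite derivnS -(Tlin_deriv_recurrence Smx3).
pose f s := mu_band j s *: (S ^+ (s - j.+1) * (Tlin S * u^`(l))`_s).
rewrite (@sum_three_diagonals _ f j).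
- rewrite /f /mu_band !eqxx !subSS subnn expr0 mul1r.
  have [-> -> ->] : [/\ (j.+2 == j.+1 :> nat) = false, (j.+3 == j.+1 :> nat) = false
      & (j.+3 == j.+2 :> nat) = false] by split; apply/eqP; lia.
  have [-> ->] : (j.+1 - j = 1 /\ j.+2 - j = 2)%N by lia.
  by rewrite scaler_nat scale1r scaleN1r expr1.
- by move=> s /mu_band_eq0 sj; rewrite /f sj scale0r.
- move=> s Ms; rewrite /f (Tlin_derivn_high Smx3 u0) ?mulr0 ?scaler0 //; lia.
Qed.

(** The polynomial delta of the explicit operator, beta = theta + T delta. For
    theta of degree at most M one has q^(M) = 0, so the series stops there. *)
Definition Bpoly (q : {poly M3}) (z : C) : {poly M3} :=
  \sum_(l < M) ((-1) ^+ l.+1 / z ^+ l.+1)%:A%:P * q^`(l).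

Lemma coef_sum_X (a : nat -> M3) th : th = \sum_(i < M.+1) (a i)%:P * 'X^i ->
  forall k, th`_k = if (k <= M)%N then a k else 0.
Proof.
move=> -> k; under eq_bigr do rewrite mul_polyC.
by rewrite -poly_def coef_poly ltnS.
Qed.

(** T q has degree less than M, as its coefficients are the P_k(theta). *)
Lemma Tlin_quotient_tail (a : nat -> M3) th phi q :
  th = \sum_(i < M.+1) (a i)%:P * 'X^i ->
  th * Tlin S = Tlin S * phi -> phi^`() = q * Tlin S ->
  forall k, (M <= k)%N -> (Tlin S * q)`_k = 0.
Proof.
move=> tha E1 E2 k Mk.
rewrite (coef_Tlin_Pmap E1 E2) Pmap_cov_deriv /cov_deriv !coefB.
rewrite coef_Tadj_mul coef_mul_Tadj coefXnM coef_deriv.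
have th0 i : (M < i)%N -> th`_i = 0 by rewrite (coef_sum_X tha) ltnNge => /negbTE ->.
rewrite /= !subSS !subn0 (th0 k.+1) ?(th0 k.+2) ?(th0 k.+3) //; try lia.
by rewrite !(mulr0, mul0r, subr0, addr0, mul0rn, oppr0).
Qed.

(** The coefficient of x^j in T q^(l) vanishes for l >= M - j, so the upper bound
    of the sum over l may depend on j or not. *)
Lemma Bcoef_Bpoly (a : nat -> M3) th phi q (z : C) j :
  th = \sum_(i < M.+1) (a i)%:P * 'X^i ->
  th * Tlin S = Tlin S * phi -> phi^`() = q * Tlin S -> (j <= M)%N ->
  Bcoef M a th j z = (th + Tlin S * Bpoly q z)`_j.
Proof.
move=> tha E1 E2 jM; have Pq := coef_Tlin_Pmap E1 E2.
have th_a := coef_sum_X tha; have q0 := Tlin_quotient_tail tha E1 E2.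
rewrite /Bcoef coefD th_a jM; congr (_ + _).
rewrite /Bpoly mulr_sumr coef_sum.
rewrite -(big_mkord predT
  (fun l => (Tlin S * (((-1) ^+ l.+1 / z ^+ l.+1)%:A%:P * q^`(l)))`_j)).
rewrite big_add1 /= (big_nat_widen _ _ M) ?leq_subr //.
rewrite big_mkcond /= !big_mkord; apply: eq_bigr => l _.
rewrite mul_scalarCA coefCM mulr_algl.
case: ltnP => jl; last first.
  by rewrite (Tlin_derivn_high Smx3 q0) ?scaler0 //; lia.
congr (_ *: _).
pose jo : 'I_M.+1 := Ordinal (jM : (j < M.+1)%N).
rewrite -(mu_powers q0 l jo) (big_nat_widenl _ 0) // big_mkcond big_mkord.
apply: eq_bigr => r _ /=; rewrite addnS /= Pq.
have -> : inord j = jo by apply: val_inj; rewrite /= inordK.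
rewrite inord_val; case: leqP => [_|rj]; last by rewrite mu_exp_eq0 ?scale0r.
by congr (_ *: (_ ^+ _ * _)); lia.
Qed.

Lemma Bcoef_bispectral (a : nat -> M3) th (x z : C) :
  th = \sum_(i < M.+1) (a i)%:P * 'X^i -> tame (Tlin S) th ->
  x != 0 -> z != 0 -> bispectral_at M (Bcoef M a th) th x z.
Proof.
move=> tha [phi [q [E1 E2]]] x0 z0; apply/bispectral_atE => //.
have q0 := Tlin_quotient_tail tha E1 E2.
have -> : \poly_(j < M.+1) Bcoef M a th j z = th + Tlin S * Bpoly q z.
  apply/polyP => j; rewrite coef_poly ltnS; case: leqP => [jM|Mj].
    exact: (Bcoef_Bpoly z tha E1 E2).
  rewrite coefD; have -> : th`_j = 0.
    by rewrite (coef_sum_X tha) leqNgt Mj.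
  rewrite /Bpoly mulr_sumr coef_sum big1 ?addr0 // => l _.
  rewrite mul_scalarCA coefCM (Tlin_derivn_high Smx3 q0) ?mulr0 //; lia.
rewrite (tame_intertwining (Tlin_monic S) (deriv_Tlin S) (mul_Tlin_Tadj Smx3)
  E1 E2) ?horner0 //.
apply: neumann_resolvent => //.
exact: (Tlin_derivn_eq0 Smx3 q0).
Qed.

End Formula.

(** * The domain and the coefficients of the operator *)

Lemma derivable_horner (p : {poly C}) (h : C -> C) (w : C) :
  derivable h w 1 -> derivable (fun u => p.[h u]) w 1.
Proof.
move=> dh; elim/poly_ind: p => [|p c IH].
  rewrite [X in derivable X _ _](_ : _ = cst 0); first exact: derivable_cst.
  by apply/funext => u; rewrite horner0.
rewrite [X in derivable X _ _](_ : _ = ((fun u => p.[h u]) * h + cst c)).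
  exact: (derivableD (derivableM IH dh) (derivable_cst c w 1)).
by apply/funext => u; rewrite hornerMXaddC.
Qed.

(** At 0 the pole is removed by w^n: the function w^n p(1/w) is the
    polynomial g. *)
Lemma meromorphic_horner_inv (p : {poly C}) (z : C) :
  meromorphic_at (fun w => p.[w^-1]) z.
Proof.
have [->|z0] := eqVneq z 0; last first.
  exists 0%N, (fun w => p.[w^-1]); split; last first.
    by rewrite near_withinE; apply: nearW => w _; rewrite expr0 divr1.
  have nz := nbhs_neq z0.
  rewrite /holomorphic_at; near=> w; apply: derivable_horner.
  apply: (@derivableV _ _ (@id C)); last exact: derivable_id.
  by near: w.
pose n := size p; pose g : {poly C} := \sum_(i < n) p`_i *: 'X^(n - i).
exists n, (horner g); split.
  by rewrite /holomorphic_at; near=> w; apply: derivable_horner; exact: derivable_id.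
rewrite near_withinE; apply: nearW => w w0.
rewrite subr0 /g horner_sum horner_coef mulr_suml; apply: eq_bigr => i _.
rewrite hornerZ hornerXn -mulrA; congr (_ * _).
by rewrite exprVn expfB // mulrAC mulfV ?mul1r // expf_neq0.
Unshelve. all: by end_near. Qed.

Lemma Bcoef_meromorphic M a th j : mx_meromorphic_on [set: C] (Bcoef M a th j).
Proof.
move=> z _ i k.
pose K l : M3 := \sum_((j + l).-1 <= r < M.+1)
        (mu_mx R M ^+ l.-1) (inord j) (inord r) *: (S ^+ (r.+1 - j - l) * Pmap r th).
pose p : {poly C} := (a j i k)%:P
  + \sum_(1 <= l < (M - j).+1) ((-1) ^+ l * K l i k) *: 'X^l.
have -> : (fun w => Bcoef M a th j w i k) = (fun w => p.[w^-1]).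
  apply/funext => w; rewrite /Bcoef mxE /p hornerD hornerC; congr (_ + _).
  rewrite summxE horner_sum; apply: eq_bigr => l _.
  by rewrite mxE hornerZ hornerXn exprVn mulrAC.
exact: meromorphic_horner_inv.
Qed.

Lemma real_complex_continuous : continuous (fun t : R => (t%:C)%C : C).
Proof.
move=> t; apply/cvgrPdist_lt => e e0.
have [er er0 ee] : exists2 er : R, 0 < er & e = er%:C%C.
  exists (complex.Re e); first by move: e0; rewrite ltcE /= => /andP[].
  by apply/esym/RRe_real/gtr0_real.
apply/nbhs_ballP; exists er => //= s; rewrite /ball /= => ts.
by rewrite ee -rmorphB normc_def /= expr0n addr0 sqrtr_sqr ltcR.
Qed.

(** A disc is the union of the segments that join its points to its centre. *)
Lemma connected_ball1 : connected (ball (1 : C) (1 : C)).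
Proof.
pose seg (z : C) := (fun t : R => 1 + t%:C%C * (z - 1) : C) @` `[0, 1].
have -> : ball (1 : C) (1 : C) = \bigcup_(z in ball (1 : C) (1 : C)) seg z.
  apply/seteqP; split=> [z bz|_ [z bz [t /= + <-]]].
    exists z => //; exists 1; first by rewrite /= in_itv /= ler01 lexx.
    by rewrite rmorph1 mul1r addrC subrK.
  rewrite in_itv /= => /andP[t0 t1]; move: bz; rewrite /ball /=.
  rewrite opprD addNKr normrN normrM distrC => bz.
  apply: le_lt_trans bz; rewrite ler_piMl // normc_def /= expr0n addr0 sqrtr_sqr.
  by rewrite ger0_norm // -[1]/(1%:C%C) lecR.
apply: bigcup_connected.
  exists 1 => z _; exists 0; first by rewrite /= in_itv /= ler01 lexx.
  by rewrite rmorph0 mul0r addr0.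
move=> z _; apply: connected_continuous_connected; first exact: segment_connected.
apply: continuous_subspaceT => t; apply: cvgD; first exact: cvg_cst.
apply: cvgM; [exact: real_complex_continuous|exact: cvg_cst].
Qed.

Lemma Gamma_bisp_alg (th : {poly M3}) : Gamma th -> bisp_alg th.
Proof.
move=> /Gamma_tame ok; pose M := size th.
have thM : th = \sum_(i < M.+1) (th`_i)%:P * 'X^i.
  rewrite -{1}[th]coefK poly_def big_ord_recr /= nth_default // mul0r addr0.
  by apply: eq_bigr => i _; rewrite mul_polyC.
(* this disc does not contain 0, where the coefficients have their pole and the
   values of the total functions are meaningless *)
exists (ball (1 : C) 1), M, (Bcoef M (fun i => th`_i) th); split; last first.
  move=> x z x0 bz _; apply: Bcoef_bispectral => //.
  by apply: contraTneq bz => ->; rewrite /ball /= subr0 normr1 ltxx.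
split; [exact: ball_open| exact: connected_ball1|by exists 1; exact: ballxx|].
by move=> j _ z _; exact: Bcoef_meromorphic.
Qed.

End Bispectral.

Theorem corollary8 (R : realType) :
  [/\ is_subalgebra (@Gamma R),
      @Gamma R = @bisp_alg R &
      forall (theta : {poly 'M[CC R]_3}) (M : nat) (a : nat -> 'M[CC R]_3),
        Gamma theta ->
        theta = \sum_(j < M.+1) (a j)%:P * 'X^j ->
        (forall j, (j <= M)%N -> mx_meromorphic_on [set: CC R] (Bcoef M a theta j))
        /\ (forall x z : CC R, x != 0 -> z != 0 ->
              bispectral_at M (Bcoef M a theta) theta x z)].
Proof.
split.
- split=> [|c th eta /Gamma_tame th_ok /Gamma_tame eta_ok|th eta].
  + by apply/Gamma_tame; exact: tame1.
  + by apply/Gamma_tame; rewrite -mul_polyC -scalar_algE; exact: tame_linear.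
  + by move=> /Gamma_tame th_ok /Gamma_tame eta_ok; apply/Gamma_tame; exact: tameM.
- apply/seteqP; split=> th; first exact: Gamma_bisp_alg.
  by move/bisp_alg_tame/Gamma_tame.
- move=> th M a /Gamma_tame ok tha; split=> [j _|x z x0 z0].
    exact: Bcoef_meromorphic.
  exact: Bcoef_bispectral.
Qed.
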